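(* Let $A\in\mathbb{R}^{n\times n}$ and $B\in\mathbb{R}^{n\times m}$, and let $\mathcal{R}:=[\,B\;|\;AB\;|\;A^2B\;|\;\cdots\;|\;A^{n-1}B\,]\in\mathbb{R}^{n\times nm}$ be the controllability matrix of the pair $(A,B)$. Assume that: (i) $\mathcal{R}$ has no zero rows; (ii) the set $J:=\{j\in[1,nm] : \mathcal{R}\mathbf{e}_j \text{ is unisigned}\}$ satisfies $\left|\bigcup_{j\in J}\overline{\mathrm{ZP}}(\mathcal{R}\mathbf{e}_j)\right|\ge n-1$. Then the pair $(A,B)$ is herdable.
   Context: For integers $k\le n$, $[k,n]$ denotes the integer set $\{k,k+1,\dots,n\}$. $\mathbf{e}_j$ is the $j$-th canonical basis vector (of the appropriate dimension), so $M\mathbf{e}_j$ is the $j$-th column of the matrix $M$. For a vector $\mathbf{v}\in\mathbb{R}^n$, $\overline{\mathrm{ZP}}(\mathbf{v})=\{i\in[1,n]:[\mathbf{v}]_i\neq 0\}$ is its non-zero pattern. A nonzero vector is unisigned if all its nonzero entries have the same sign (the zero vector is not unisigned). Herdability: the pair $(A,B)$ describes the linear time-invariant system $\dot{\mathbf{x}}(t)=A\mathbf{x}(t)+B\mathbf{u}(t)$ (or its discrete-time counterpart $\mathbf{x}(t+1)=A\mathbf{x}(t)+B\mathbf{u}(t)$). The pair is (completely) herdable if for every $\mathbf{x}(0)$ and every $h>0$ there exist a time $t_f>0$ and an input $\mathbf{u}(t)$, $t\in[0,t_f)$, driving the state from $\mathbf{x}(0)$ to some $\mathbf{x}(t_f)\ge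 h\mathbf{1}_n$ (entrywise, $\mathbf{1}_n$ the all-ones vector). It is known that (in both continuous and discrete time) this is equivalent to the image (column space) of the controllability matrix $[B\,|\,AB\,|\,\cdots\,|\,A^{n-1}B]$ containing a vector all of whose entries are positive. *)

(* Defs.v *)
From HB Require Import structures.
From mathcomp Require Import all_boot all_order all_algebra.
From mathcomp Require Import all_classical all_reals all_analysis.
Set Implicit Arguments.
Unset Strict Implicit.
Unset Printing Implicit Defensive.
Import Order.TTheory GRing.Theory Num.Theory.
Import numFieldNormedType.Exports.
Local Open Scope classical_set_scope.
Local Open Scope ring_scope.

Definition controllability_mx (R : realType) (n m : nat)
    (A : 'M[R]_n) (B : 'M[R]_(n, m)) : 'M[R]_(n, \sum_(k < n) m) :=
  \mxrow_(k < n) (A ^+ k *m B).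

Definition nonzero_pattern (R : realType) (n : nat) (v : 'cV[R]_n) :
    {set 'I_n} :=
  [set i | v i 0 != 0]%SET.

Definition unisigned (R : realType) (n : nat) (v : 'cV[R]_n) : bool :=
  (v != 0) &&
  [forall i, forall j, (v i 0 != 0) ==> (v j 0 != 0) ==>
     (Num.sg (v i 0) == Num.sg (v j 0))].

Definition discrete_herdable (R : realType) (n m : nat)
    (A : 'M[R]_n) (B : 'M[R]_(n, m)) : Prop :=
  forall (x0 : 'cV[R]_n) (h : R), 0 < h ->
  exists (tf : nat) (u : nat -> 'cV[R]_m) (x : nat -> 'cV[R]_n),
    [/\ (0 < tf)%N,
        x 0%N = x0,
        forall t : nat, (t < tf)%N -> x t.+1 = A *m x t + B *m u t
      & forall i : 'I_n, h <= x tf i 0].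

(* Inputs are continuous on [0, tf].  The state is continuous on [0, tf] and
   satisfies the equation at the interior times; since the input is continuous,
   this forces the one-sided derivatives at 0 and tf to satisfy it as well.
   Larger input classes (piecewise continuous, locally integrable) give the
   same notion of herdability. *)
Definition continuous_herdable (R : realType) (n m : nat)
    (A : 'M[R]_n) (B : 'M[R]_(n, m)) : Prop :=
  forall (x0 : 'cV[R]_n) (h : R), 0 < h ->
  exists (tf : R) (u : R -> 'cV[R]_m) (x : R -> 'cV[R]_n),
    [/\ 0 < tf,
        {within `[0, tf], continuous u} /\ {within `[0, tf], continuous x},
        x 0 = x0,
        forall t : R, 0 < t < tf ->
          is_derive t 1 x (A *m x t + B *m u t)
      & forall i : 'I_n, h <= x tf i 0].

(* Main.v *)
Require Import Defs.
From HB Require Import structures.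
From mathcomp Require Import all_boot all_order all_algebra.
From mathcomp Require Import all_classical all_reals all_analysis.
From mathcomp Require Import zify.
Import Order.TTheory GRing.Theory Num.Theory.
Import numFieldNormedType.Exports.
Local Open Scope ring_scope.

(** Weight each unisigned column of the controllability
    matrix by its sign and add them up: no cancellation occurs, so the sum is
    nonnegative, and positive exactly on the union of the patterns.  At most one
    row [i0] is left over; some column is nonzero there.  Adding that column,
    with the sign that makes its entry [i0] positive, to a large multiple of the
    first sum gives a vector of the image with positive entries only
    ([positive_in_image]).

    Once the image contains a positive vector [p], every state is driven above
    every height: the final state is a free response, independent of the input,
    plus a forced response that may be any multiple of [p], and a large enough
    multiple dominates.  In discrete time the coefficients of [p] on the blocks
    [A^k B], in reversed order, are the input ([discrete_of_positive]).

    In continuous time the free response is the matrix exponential, built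
    entrywise as a power series ([flow]).  The forced response is a polynomial
    trajectory from [0] to [p] over the unit time interval
    ([poly_reachable_ctrb]).  It is enough to reach [A^k b] with [b = B w], by
    linearity.  Let [chi] be the characteristic polynomial of [A], and write [D]
    for differentiation.  The quotient of [chi(D) - chi(A)] by [D - A] is
    [sum_i D^i P_(i+1)], where [P_i] is [chi] with its terms of degree below [i]
    dropped, divided by [X^i] and evaluated at [A].  Since [chi(A) = 0], for
    each scalar polynomial [psi] the state [sum_i psi^(i) P_(i+1) b] solves
    [x' = A x + chi(D)psi b].  The powers of [A] are combinations of
    [P_1, ..., P_n] ([pow_horner_tail]), so it suffices to prescribe the
    derivatives of [psi] of order below [n] at both end points, which is Hermite
    interpolation ([poly_endpoint_jets]). *)

(** * A positive vector in the image *)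

Lemma exists_large_multiple {R : realFieldType} {I : finType} {p : I -> R} (y : I -> R) :
  (forall i, 0 < p i) -> exists c : R, forall i, y i <= c * p i.
Proof.
move=> p_gt0; exists (\sum_i `|y i| / p i) => i.
rewrite -ler_pdivrMr// (bigD1 i)//=.
apply: le_trans (_ : `|y i| / p i <= _); first by rewrite ler_pM2r ?invr_gt0// ler_norm.
by rewrite lerDl sumr_ge0// => j _; rewrite divr_ge0// ltW.
Qed.

(** The sign-weighted sum of the unisigned columns vanishes off their patterns,
    that is, in at most one row [i0].  A column nonzero at [i0] repairs that row,
    and a large multiple of the sum absorbs its entries in all the others. *)
Lemma positive_in_image {R : realType} {n k} {M : 'M[R]_(n, k)} :
    (forall i, row i M != 0) ->
    (n - 1 <= #|(\bigcup_(j in [set j | unisigned (col j M)])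
                  nonzero_pattern (col j M))%SET|)%N ->
  exists w : 'cV[R]_k, forall i, 0 < (M *m w) i 0.
Proof.
move=> rowM_neq0; set J := [set j | unisigned (col j M)]%SET.
set S := (\bigcup_(j in _) _)%SET => large_S.
(* the common sign of the nonzero entries of a unisigned column [j] *)
pose s j := if [pick i | M i j != 0] is Some i then Num.sg (M i j) else 0.
have sP j i : j \in J -> M i j * s j = `|M i j|.
  rewrite inE /s => /andP[_ /forallP sgM]; case: pickP => [i0 Mi0|Mj0]; last first.
    by have /negPn/eqP -> := negbT (Mj0 i); rewrite mul0r normr0.
  have [->|Mij] := eqVneq (M i j) 0; first by rewrite mul0r normr0.
  have /forallP/(_ i0) := sgM i; rewrite !mxE Mi0 Mij /= => /eqP <-.
  by rewrite mulrC -normrEsg.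
pose w0 : 'cV[R]_k := \col_j (if j \in J then s j else 0).
pose v := M *m w0.
have vE i : v i 0 = \sum_(j in J) `|M i j|.
  rewrite mxE [RHS]big_mkcond; apply: eq_bigr => j _; rewrite mxE.
  by case: ifP => [/sP->//|_]; rewrite mulr0.
have v_gt0 i : i \in S -> 0 < v i 0.
  case/bigcupP => j jJ; rewrite inE mxE -normr_gt0 => Mij.
  by rewrite vE (bigD1 j)//= ltr_wpDr// sumr_ge0.
have v_eq0 i : i \notin S -> v i 0 = 0.
  move=> /bigcupP iS; rewrite vE big1// => j jJ.
  by apply/eqP; rewrite normr_eq0; apply/negPn/negP => Mij; apply: iS; exists j; rewrite // inE mxE.
have [i0|[i0 i0S]] : (forall i, i \in S) \/ exists i, i \notin S.
- have [/forallP|/forallPn] := boolP [forall i, i \in S]; by [left|right].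
- by exists w0 => i; exact: v_gt0.
have S_others i : i != i0 -> i \in S.
  move=> i_neq; apply: contraT => iS.
  have : (2 <= #|~: S|)%N.
    rewrite -[2%N](_ : #|[set i; i0]%SET| = _); last by rewrite cards2 i_neq.
    by apply: subset_leq_card; apply/fintype.subsetP => j; rewrite !inE => /orP[] /eqP ->.
  have := cardsC S; rewrite card_ord; move: large_S; lia.
have /rV0Pn[j0] := rowM_neq0 i0; rewrite mxE => Mij0.
pose g := M *m (Num.sg (M i0 j0) *: delta_mx j0 0 : 'cV[R]_k).
have g0 : 0 < g i0 0.
  by rewrite /g -scalemxAr -colE !mxE -normrEsg normr_gt0.
(* the value 1 is a filler at [i0], where [v] vanishes *)
have p_gt0 i : 0 < (if i \in S then v i 0 else 1) by case: ifP => // /v_gt0.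
have [c cP] := exists_large_multiple (fun i => 1 - g i 0) p_gt0.
exists (c *: w0 + Num.sg (M i0 j0) *: delta_mx j0 0) => i.
rewrite mulmxDr -scalemxAr -/v -/g mxE [(c *: v) i 0]mxE.
have [iS|iS] := boolP (i \in S).
  by have := cP i; rewrite iS lerBlDr; apply: lt_le_trans.
rewrite v_eq0// mulr0 add0r.
by have [->//|/S_others] := eqVneq i i0; rewrite (negPf iS).
Qed.

(** * Discrete time *)

(** By variation of constants the forced part of the state at time [T] is the sum
    of [A^(T-1-s) B u(s)]; reading the blocks of [w] backwards makes it a
    multiple of the positive vector. *)
Lemma discrete_of_positive {R : realType} {n m : nat} (A : 'M[R]_n) (B : 'M[R]_(n, m))
    (w : 'cV[R]_(\sum_(k < n) m)) :
  (forall i, 0 < (controllability_mx A B *m w) i 0) -> discrete_herdable A B.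
Proof.
move=> p_gt0 x0 h _.
(* The horizon is [n + 1] rather than [n] so that it is positive when [n = 0];
   the extra input [ws n] is zero. *)
pose ws (k : nat) : 'cV[R]_m :=
  if (insub k : option 'I_n) is Some i then submxcol (p_ := fun=> m) w i else 0.
have [c cP] := exists_large_multiple
  (fun i => h - (A ^+ n.+1 *m x0) i 0) p_gt0.
pose u t := c *: ws (n - t)%N.
pose x := fix x t := if t is t'.+1 then A *m x t' + B *m u t' else x0.
exists n.+1, u, x; split=> // i.
have mulA_exp t : A *m A ^+ t = A ^+ t.+1 by rewrite exprS.
have xE t : x t = A ^+ t *m x0 + \sum_(s < t) A ^+ (t - s.+1) *m (B *m u s).
  elim: t => [|t IH]; first by rewrite expr0 mul1mx big_ord0 addr0.
  rewrite big_ord_recr /= subnn mul1mx addrA IH mulmxDr mulmxA mulA_exp; congr (_ + _ + _).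
  rewrite mulmx_sumr; apply: eq_bigr => s _.
  by rewrite mulmxA mulA_exp -subSn// ltn_ord.
have -> : x n.+1 = A ^+ n.+1 *m x0 + c *: (controllability_mx A B *m w).
  rewrite xE; congr (_ + _).
  rewrite -[w in RHS]submxcolK mul_mxrow_mxcol scaler_sumr.
  rewrite (reindex_inj rev_ord_inj) big_ord_recr /=.
  have -> : u (n.+1 - n.+1)%N = 0.
    by rewrite /u subnn subn0 /ws insubN ?ltnn// scaler0.
  rewrite !mulmx0 addr0; apply: eq_bigr => s _.
  rewrite /u subSS !subKn 1?ltnW// /ws valK -!scalemxAr.
  by rewrite -mulmxA.
have addZE (y z : 'cV[R]_n) : (y + c *: z) i 0 = y i 0 + c * z i 0 by rewrite !mxE.
by rewrite addZE -lerBlDl.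
Qed.

(** * Hermite interpolation at two points *)

(** Each differentiation lowers the multiplicity of the root [a] by exactly one
    in characteristic zero: [(r Y^(k+1))' = (r' Y + (k+1) r) Y^k] for
    [Y = X - a], and the new cofactor is [(k+1) r] at [a]. *)
Lemma derivn_mul_XsubC_exp {R : numFieldType} (a : R) (i k : nat) (q : {poly R}) :
  exists r : {poly R},
    (q * ('X - a%:P) ^+ (k + i))^`(i) = r * ('X - a%:P) ^+ k /\
    (q.[a] != 0 -> r.[a] != 0).
Proof.
elim: i k => [|i IH] k; first by exists q; rewrite addn0 derivn0.
have [r [Dr r_neq0]] := IH k.+1.
exists (r^`() * ('X - a%:P) + r *+ k.+1); split; last first.
  by move/r_neq0; rewrite hornerD hornerM hornerXsubC subrr mulr0 add0r hornerMn mulrn_eq0.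
rewrite addnS -addSn derivnS Dr derivM deriv_exp derivXsubC mul1r /=.
by rewrite mulrDl -mulrA -exprS mulrnAr mulrnAl.
Qed.

(** Two-point Hermite interpolation in the Newton style: adding a multiple of
    ['X^N * ('X - 1)^n] adjusts the derivative of order [n] at [1] and disturbs
    neither the lower ones nor those at [0] of order below [N]. *)
Lemma poly_endpoint_jets {R : numFieldType} (N n : nat) (d : nat -> R) :
  exists p : {poly R},
    (forall i, (i < N)%N -> p^`(i).[0] = 0) /\
    (forall i, (i < n)%N -> p^`(i).[1] = d i).
Proof.
have flat (a : R) i k (q : {poly R}) :
    (i < k)%N -> (q * ('X - a%:P) ^+ k)^`(i).[a] = 0.
  move=> ik; have [r [Dr _]] := derivn_mul_XsubC_exp a i (k - i) q.
  move: Dr; rewrite subnK 1?ltnW// => ->.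
  by rewrite hornerM horner_exp hornerXsubC subrr expr0n subn_eq0 leqNgt ik mulr0.
elim: n => [|n [p [p0 p1]]]; first by exists 0; split=> // i _; rewrite linear0 horner0.
have [r [Dr]] := derivn_mul_XsubC_exp (1 : R) n 0 ('X ^+ N).
rewrite add0n expr0 mulr1 in Dr.
rewrite hornerXn expr1n oner_neq0 => /(_ isT) r1.
pose c := (d n - p^`(n).[1]) / r.[1].
exists (p + c *: ('X ^+ N * ('X - 1%:P) ^+ n)); split=> i.
  move=> iN; rewrite linearD linearZ hornerD hornerZ p0//=.
  have -> : 'X^N = ('X - (0 : R)%:P) ^+ N by rewrite subr0.
  by rewrite [X in X^`(i)]mulrC flat// mulr0 addr0.
rewrite ltnS leq_eqVlt => /predU1P[->|lt_in].
  by rewrite linearD linearZ /= hornerD hornerZ Dr divfK// subrKC.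
by rewrite linearD linearZ /= hornerD hornerZ p1// flat// mulr0 addr0.
Qed.

(** * Horner tails of the characteristic polynomial *)

Section HornerTails.
Context {R : comNzRingType} {n' : nat}.
Let n := n'.+1.
Implicit Types A : 'M[R]_n.

(** These are the matrix coefficients of the quotient of
    [chi(s) - chi(A)] by [s - A], i.e. of the adjugate of [s - A]: the coefficient
    of [s^i] is [horner_tail A i.+1]. *)
Definition horner_tail A i : 'M[R]_n := horner_mx A (drop_poly i (char_poly A)).

Lemma horner_tail0 A : horner_tail A 0 = 0.
Proof. by rewrite /horner_tail drop_poly0l Cayley_Hamilton. Qed.

(** Horner's scheme: consecutive tails of a polynomial [q] satisfy
    [q_i = X q_(i+1) + c_i]. *)
Lemma mul_horner_tailS A i :
  A *m horner_tail A i.+1 = horner_tail A i - ((char_poly A)`_i)%:M.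
Proof.
apply/eqP; rewrite eq_sym subr_eq; apply/eqP.
have -> : horner_tail A i =
    horner_mx A ('X * drop_poly i.+1 (char_poly A) + ((char_poly A)`_i)%:P).
  congr horner_mx; apply/polyP => j.
  rewrite coefD coefXM coefC !coef_drop_poly.
  by case: j => [|j] /=; rewrite ?add0r ?add0n// addr0 addSnnS.
by rewrite rmorphD rmorphM /= horner_mx_X horner_mx_C.
Qed.

Lemma horner_tail_size A : horner_tail A n = 1%:M.
Proof.
rewrite /horner_tail.
suff -> : drop_poly n (char_poly A) = 1%:P by rewrite horner_mx_C.
apply/polyP => j; rewrite coef_drop_poly coefC.
case: j => [|j] /=; last by rewrite nth_default// size_char_poly addSnnS leq_addl.
by have /monicP := char_poly_monic A; rewrite lead_coefE size_char_poly.
Qed.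

(** Multiplication by [A] shifts the tails down and adds a scalar matrix, which is
    a multiple of the last tail [1]; the first tail shifts to [chi(A) = 0].  So
    the span of the tails, which contains [1], is stable under [A]. *)
Lemma pow_horner_tail A k :
  exists d : nat -> R, A ^+ k = \sum_(i < n) d i *: horner_tail A i.+1.
Proof.
elim: k => [|k [d Dk]].
  exists (fun i => (i == n')%:R).
  rewrite big_ord_recr /= big1 => [|i _]; last by rewrite ltn_eqF ?scale0r.
  by rewrite eqxx scale1r add0r horner_tail_size expr0.
pose s := \sum_(i < n) d i * (char_poly A)`_i.
exists (fun i => if i == n' then - s else d i.+1).
rewrite exprS {}Dk mulr_sumr.
under eq_bigr => i _.
  rewrite -scalerAr [A * _]mul_horner_tailS scalerBr scale_scalar_mx.
  over.
rewrite sumrB -(raddf_sum (@scalar_mx R n)) -/s.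
rewrite big_ord_recl horner_tail0 scaler0 add0r [RHS]big_ord_recr /= eqxx.
rewrite horner_tail_size scaleNr scale_scalar_mx mulr1; congr (_ - _).
by apply: eq_bigr => i _; rewrite ltn_eqF.
Qed.

End HornerTails.

(** * Polynomial trajectories *)

(** The state and input are vectors of polynomials in time, so that the equation
    is an identity between polynomials; the time interval is [[0, 1]]. *)
Definition poly_reachable {R : numFieldType} {n m : nat}
    (A : 'M[R]_n) (B : 'M[R]_(n, m)) (p : 'cV[R]_n) : Prop :=
  exists (X : 'cV[{poly R}]_n) (U : 'cV[{poly R}]_m),
    [/\ map_mx (@deriv R) X = map_mx polyC A *m X + map_mx polyC B *m U,
        map_mx (horner_eval 0) X = 0 & map_mx (horner_eval 1) X = p].

Lemma poly_reachable0 {R : numFieldType} {n m : nat} (A : 'M[R]_n) (B : 'M[R]_(n, m)) :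
  poly_reachable A B 0.
Proof. by exists 0, 0; split; rewrite ?raddf0 ?mulmx0 ?addr0. Qed.

Lemma poly_reachableD {R : numFieldType} {n m : nat} (A : 'M[R]_n) (B : 'M[R]_(n, m)) p q :
  poly_reachable A B p -> poly_reachable A B q -> poly_reachable A B (p + q).
Proof.
move=> [X [U [dX X0 X1]]] [Y [V [dY Y0 Y1]]].
exists (X + Y), (U + V); split; rewrite map_mxD.
- by rewrite dX dY !mulmxDr addrACA.
- by rewrite X0 Y0 addr0.
- by rewrite X1 Y1.
Qed.

(** With [b = B w] the trajectory is [sum_i psi^(i) P_(i+1) b], driven by
    [u = chi(D)psi w].  Its final value is [sum_i d_i P_(i+1) b = A^k b] as soon
    as the derivatives of [psi] at [1] are the coordinates [d_i] of [A^k] on the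
    tails. *)
Lemma poly_reachable_pow {R : numFieldType} {n m : nat} (A : 'M[R]_n) (B : 'M[R]_(n, m))
    k (w : 'cV[R]_m) : poly_reachable A B (A ^+ k *m (B *m w)).
Proof.
case: n A B => [|n'] A B; first by rewrite [_ *m _]flatmx0; exact: poly_reachable0.
have [d Dk] := pow_horner_tail A k.
have [psi [psi0 psi1]] := poly_endpoint_jets n'.+1 n'.+1 d.
pose b := B *m w; pose chi := char_poly A.
pose X : 'cV[{poly R}]_n'.+1 := \sum_(i < n'.+1)
  psi^`(i) *: map_mx polyC (horner_tail A i.+1 *m b).
pose U : 'cV[{poly R}]_m := (\sum_(i < n'.+2) chi`_i *: psi^`(i)) *: map_mx polyC w.
exists X, U; split.
- have -> : map_mx (@deriv R) X =
      \sum_(i < n'.+1) psi^`(i.+1) *: map_mx polyC (horner_tail A i.+1 *m b).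
    apply/matrixP => i j; rewrite mxE !summxE raddf_sum /=; apply: eq_bigr => l _.
    by rewrite !mxE derivM derivC mulr0 addr0 -derivnS.
  have -> : map_mx polyC A *m X =
      \sum_(i < n'.+1) (psi^`(i) *: map_mx polyC (horner_tail A i *m b)
                        - (chi`_i *: psi^`(i)) *: map_mx polyC b).
    rewrite mulmx_sumr; apply: eq_bigr => i _.
    rewrite -scalemxAr -map_mxM mulmxA mul_horner_tailS mulmxBl mul_scalar_mx.
    rewrite map_mxB map_mxZ scalerBr; congr (_ - _).
    by rewrite scalerA mulrC mul_polyC.
  (* [X'] and the tail part of [A X] are the same sum up to a shift of index.  The
     end term of index 0 is zero by Cayley-Hamilton, and the one of index [n]
     supplies the leading term of [chi(D)psi]. *)
  rewrite -scalemxAr -map_mxM -/b sumrB -scaler_suml -addrA [- _ + _]addrC -scalerBl.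
  rewrite [\sum_(i < n'.+2) _]big_ord_recr /=.
  have -> : chi`_n'.+1 = 1.
    by have /monicP := char_poly_monic A; rewrite lead_coefE size_char_poly.
  rewrite [(\sum_(i < n'.+1) chi`_i *: _ + _)]addrC addrK scale1r.
  rewrite [in RHS]big_ord_recl horner_tail0 mul0mx raddf0 scaler0 add0r.
  by rewrite [LHS]big_ord_recr /= horner_tail_size mul1mx.
- apply/matrixP => i j; rewrite mxE summxE /horner_eval horner_sum big1 ?mxE// => l _.
  by rewrite !mxE hornerM psi0 ?mul0r.
- rewrite Dk mulmx_suml; apply/matrixP => i j.
  rewrite mxE !summxE /horner_eval horner_sum; apply: eq_bigr => l _.
  by rewrite -scalemxAl !mxE hornerM hornerC psi1.
Qed.

Lemma poly_reachable_ctrb {R : realType} {n m} (A : 'M[R]_n) (B : 'M[R]_(n, m))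
    (w : 'cV[R]_(\sum_(k < n) m)) :
  poly_reachable A B (controllability_mx A B *m w).
Proof.
rewrite -(submxcolK w) mul_mxrow_mxcol.
apply: (big_ind (poly_reachable A B)) => [|p q|k _].
- exact: poly_reachable0.
- exact: poly_reachableD.
- by rewrite -mulmxA; exact: poly_reachable_pow.
Qed.

(** * The free response *)

Definition flow_coeff {R : realType} {n : nat} (A : 'M[R]_n) (v : 'cV[R]_n) (i : 'I_n)
  : nat -> R := fun k => (A ^+ k *m v) i 0 / k`!%:R.

(** The matrix exponential [exp(tA)] applied to [v], one scalar power series per
    entry. *)
Definition flow {R : realType} {n : nat} (A : 'M[R]_n) (v : 'cV[R]_n) (t : R)
  : 'cV[R]_n := \col_i limn (pseries (flow_coeff A v i) t).

(** Differentiation stays within this family of series: it only replaces [v] by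
    [A v]. *)
Lemma pseries_diffs_flow_coeff {R : realType} {n : nat} (A : 'M[R]_n) v i :
  pseries_diffs (flow_coeff A v i) = flow_coeff A (A *m v) i.
Proof.
apply/funext => k; rewrite /pseries_diffs /flow_coeff factS natrM invfM exprSr.
by rewrite -mulmxA mulrCA mulVKf.
Qed.

(** With [M] the sum of all [|A i j|] and [C] the sum of all [|v j|], the entries
    of [A^k v] are at most [C M^k], so the series is dominated by the exponential
    series of [M |t|]. *)
Lemma is_cvg_flow_coeff {R : realType} {n : nat} (A : 'M[R]_n) v i (t : R) :
  cvgn (pseries (flow_coeff A v i) t).
Proof.
pose M : R := \sum_i \sum_j `|A i j|; pose C : R := \sum_j `|v j 0|.
have M_ge0 : 0 <= M by rewrite sumr_ge0// => ? _; rewrite sumr_ge0.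
have C_ge0 : 0 <= C by rewrite sumr_ge0.
have powA_le k j : `|(A ^+ k *m v) j 0| <= C * M ^+ k.
  elim: k j => [|k IH] j.
    by rewrite !expr0 mul1mx mulr1 /C (bigD1 j)//= lerDl sumr_ge0.
  rewrite exprS -mulmxA mxE (le_trans (ler_norm_sum _ _ _))//.
  apply: le_trans (_ : \sum_l `|A j l| * (C * M ^+ k) <= _).
    by apply: ler_sum => l _; rewrite normrM ler_wpM2l.
  rewrite -mulr_suml exprS [leRHS]mulrCA ler_wpM2r ?mulr_ge0 ?exprn_ge0//.
  by rewrite /M [leRHS](bigD1 j)//= lerDl sumr_ge0// => ? _; rewrite sumr_ge0.
apply: normed_cvg; apply: (@series_le_cvg _ _ (C *: exp_coeff (M * `|t|))).
- by move=> k /=.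
- move=> k; rewrite /= /exp_coeff.
  by rewrite mulr_ge0// divr_ge0// exprn_ge0// mulr_ge0.
- move=> k; rewrite [leRHS](_ : _ = C * ((M * `|t|) ^+ k / k`!%:R))//.
  rewrite /= /flow_coeff 2!normrM normfV normr_nat normrX.
  rewrite mulrAC exprMn !mulrA.
  by rewrite ler_pM2r ?invr_gt0 ?ltr0n ?fact_gt0// ler_wpM2r.
- by apply: is_cvg_seriesZ; exact: is_cvg_series_exp_coeff.
Qed.

(** With the previous lemmas this turns term-by-term differentiation into the
    equation [y' = A y]. *)
Lemma flow_mul {R : realType} {n : nat} (A : 'M[R]_n) v t : flow A (A *m v) t = A *m flow A v t.
Proof.
apply/colP => i; rewrite !mxE; apply: cvg_lim => //.
rewrite (_ : pseries _ _ =
    fun N => \sum_j A i j * pseries (flow_coeff A v j) t N); last first.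
  apply/funext => N; rewrite /pseries /series /=.
  under [RHS]eq_bigr do rewrite mulr_sumr.
  rewrite exchange_big /=; apply: eq_bigr => k _.
  rewrite /flow_coeff.
  have -> : A ^+ k *m (A *m v) = A *m (A ^+ k *m v).
    by rewrite !mulmxA; congr (_ *m v); rewrite -[LHS]/(_ * _) -exprSr exprS.
  rewrite [in LHS]mxE !mulr_suml.
  by apply: eq_bigr => j _; rewrite -!mulrA.
apply: cvg_big => [|j _]; first exact: add_continuous.
rewrite mxE; apply: cvgMl_tmp.
exact: is_cvg_flow_coeff.
Qed.

Lemma flow0 {R : realType} {n : nat} (A : 'M[R]_n) v : flow A v 0 = v.
Proof.
apply/colP => i; rewrite mxE; apply: lim_near_cst => //.
near=> N; rewrite /pseries /series /= -[N]prednK; last by near: N.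
rewrite big_nat_recl//= big1_seq => [|k _]; last by rewrite exprS mul0r mulr0.
by rewrite /flow_coeff !expr0 mul1mx fact0 divr1 mulr1 addr0.
Unshelve. all: by end_near. Qed.

Lemma is_derive_flow {R : realType} {n : nat} (A : 'M[R]_n) v i (t : R) :
  is_derive t 1 (fun t => flow A v t i 0) ((A *m flow A v t) i 0).
Proof.
rewrite -flow_mul mxE.
have -> : (fun t => flow A v t i 0) = (fun t => limn (pseries (flow_coeff A v i) t)).
  by apply/funext => s; rewrite mxE.
rewrite -pseries_diffs_flow_coeff.
apply: (@pseries_snd_diffs _ _ (`|t| + 1)); rewrite ?pseries_diffs_flow_coeff;
  try exact: is_cvg_flow_coeff.
by rewrite [ltRHS]ger0_norm// ltrDl.
Qed.

(** * Continuous time *)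

Lemma is_derive_colP {R : realType} {n : nat} (x : R -> 'cV[R]_n) (t : R) (dx : 'cV[R]_n) :
  (forall i, is_derive t 1 (fun s => x s i 0) (dx i 0)) -> is_derive t 1 x dx.
Proof.
move=> dxE.
have dvb : derivable x t 1 by apply/derivable_mxP => i j; rewrite ord1; exact: ex_derive.
split=> //; rewrite derive_mx//; apply/colP => i; rewrite mxE; exact: derive_val.
Qed.

Lemma continuous_within_of_is_derive {R : realType} {n : nat} (x dx : R -> 'cV[R]_n) (S : set R) :
  (forall t : R, is_derive t 1 x (dx t)) -> ({within S, continuous x})%classic.
Proof.
move=> dxE; apply: continuous_subspaceT => t.
by apply/differentiable_continuous/derivable1_diffP; exact: ex_derive.
Qed.

(** The superposition of the free response and a large multiple of a polynomial
    trajectory from [0] to the positive vector. *)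
Lemma continuous_of_positive {R : realType} {n m : nat} (A : 'M[R]_n) (B : 'M[R]_(n, m))
    (w : 'cV[R]_(\sum_(k < n) m)) :
  (forall i, 0 < (controllability_mx A B *m w) i 0) -> continuous_herdable A B.
Proof.
move=> p_gt0 x0 h _.
have [X [U [dX X0 X1]]] := poly_reachable_ctrb A B w.
have [c cP] := exists_large_multiple (fun i => h - flow A x0 1 i 0) p_gt0.
pose evX (t : R) := map_mx (horner_eval t) X.
pose evU (t : R) := map_mx (horner_eval t) U.
have ev_derive k (P : 'cV[{poly R}]_k) (t : R) i :
    is_derive t 1 (fun s => (c *: map_mx (horner_eval s) P) i 0)
      (c * ((P i 0)^`()).[t]).
  have -> : (fun s => (c *: map_mx (horner_eval s) P) i 0) = c *: horner (P i 0).
    by apply/funext => s; rewrite !mxE.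
  exact: is_deriveZ.
have evdX t : map_mx (horner_eval t) (map_mx (@deriv R) X) = A *m evX t + B *m evU t.
  have evC k l (M : 'M[R]_(k, l)) : map_mx (horner_eval t) (map_mx polyC M) = M.
    by apply/matrixP => i j; rewrite !mxE /horner_eval hornerC.
  by rewrite dX map_mxD !map_mxM /= !evC.
pose u (t : R) : 'cV[R]_m := c *: evU t.
pose x (t : R) : 'cV[R]_n := flow A x0 t + c *: evX t.
have x_derive (t : R) : is_derive t 1 x (A *m x t + B *m u t).
  apply: is_derive_colP => i.
  have -> : (fun s => x s i 0) = (fun s => flow A x0 s i 0) + (fun s => (c *: evX s) i 0).
    by apply/funext => s; rewrite mxE.
  have -> : (A *m x t + B *m u t) i 0 =
      (A *m flow A x0 t) i 0 + c * ((X i 0)^`()).[t].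
    have := congr1 (fun M : 'cV_n => M i 0) (evdX t).
    rewrite /= [in LHS]mxE [in LHS]mxE /horner_eval => ->.
    rewrite mulmxDr -!scalemxAr -addrA -scalerDr.
    by rewrite mxE; congr (_ + _); rewrite mxE.
  have dflow := is_derive_flow A x0 i t; have dX' := ev_derive _ X t i.
  exact: is_deriveD.
exists 1, u, x; split=> //.
- split; last exact: continuous_within_of_is_derive x_derive.
  apply: (@continuous_within_of_is_derive _ _ _
    (fun t => c *: map_mx (horner_eval t) (map_mx (@deriv R) U))) => t.
  by apply: is_derive_colP => i; rewrite !mxE /horner_eval; exact: ev_derive.
- by rewrite /x flow0 /evX X0 scaler0 addr0.
- move=> i; have -> : x 1 i 0 = flow A x0 1 i 0 + c * (controllability_mx A B *m w) i 0.
    by rewrite /x /evX X1; move: (controllability_mx A B *m w) => y; rewrite mxE [(c *: y) i 0]mxE.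
  by rewrite -lerBlDl.
Qed.

Theorem lemma2 (R : realType) (n m : nat) (A : 'M[R]_n) (B : 'M[R]_(n, m))
    (no_zero_row : forall i : 'I_n, row i (controllability_mx A B) != 0)
    (large_cover :
       (n - 1 <=
        #|(\bigcup_(j in [set j | unisigned (col j (controllability_mx A B))])
             nonzero_pattern (col j (controllability_mx A B)))%SET|)%N) :
  continuous_herdable A B /\ discrete_herdable A B.
Proof.
have [w w_gt0] := positive_in_image no_zero_row large_cover.
by split; [exact: continuous_of_positive w_gt0 | exact: discrete_of_positive w_gt0].
Qed.
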